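(* Let $p_n(q)=\sum_{\pi\in B_n}q^{\mathrm{pdes}(\pi)}$, $p_n^+(q)=\sum_{\pi\in B_n,\ \pi_1>0}q^{\mathrm{pdes}(\pi)}$, $p_n^-(q)=\sum_{\pi\in B_n,\ \pi_1<0}q^{\mathrm{pdes}(\pi)}$ for $n\ge1$, with $p_0=p_0^+=1$, $p_0^-=0$, and let $P(x,q)=\sum_{n\ge0}p_n(q)\frac{x^n}{n!}$, $P^+(x,q)=\sum_{n\ge0}p_n^+(q)\frac{x^n}{n!}$, $P^-(x,q)=\sum_{n\ge0}p_n^-(q)\frac{x^n}{n!}$. Then, as formal power series in $x$ with coefficients in $\mathbb{Q}(q)$, $$P(x,q)=\frac{1-q}{xq-x-q+e^{(q-1)x}},\quad P^+(x,q)=\frac{(1-x)(1-q)}{xq-x-q+e^{(q-1)x}},\quad P^-(x,q)=\frac{x(1-q)}{xq-x-q+e^{(q-1)x}}.$$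
   Context: $B_n$ is the set of signed permutations: words $\pi=\pi_1\cdots\pi_n$ with each $\pi_i\in\{1,\dots,n,\bar1,\dots,\bar n\}$ such that $|\pi_1|\cdots|\pi_n|$ is a permutation of $\{1,\dots,n\}$; $\pi_i>0$ means $\pi_i$ is unbarred, $\pi_i<0$ barred, with order $\bar1<\cdots<\bar n<1<\cdots<n$. $\mathrm{pdes}(\pi)$ is the number of indices $i\in\{1,\dots,n-1\}$ with $\pi_i,\pi_{i+1}$ both unbarred and $\pi_i>\pi_{i+1}$. *)

(* Defs.v *)
From HB Require Import structures.
From mathcomp Require Import all_boot all_order all_algebra fraction.
From mathcomp Require Import boolp.

Set Implicit Arguments.
Unset Strict Implicit.
Unset Printing Implicit Defensive.

Import Order.TTheory GRing.Theory.
Local Open Scope ring_scope.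

(* Formal power series over R, with their commutative ring structure: addition
   is coefficientwise and multiplication is the Cauchy product (a record is
   used so as not to inherit the pointwise product of functions).  The units
   are the series with invertible constant coefficient; as everywhere in
   MathComp, the inverse is extended by the identity to nonunits. *)
Record fps (R : Type) := FPS { fps_coef : nat -> R }.

HB.instance Definition _ (R : Type) := gen_eqMixin (fps R).
HB.instance Definition _ (R : Type) := gen_choiceMixin (fps R).

Section FPSRing.
Variable R : comUnitRingType.
Implicit Types f g h : fps R.

Definition fps_zero : fps R := FPS (fun=> 0).
Definition fps_one : fps R := FPS (fun n => (n == 0%N)%:R).
Definition fps_opp f : fps R := FPS (fun n => - fps_coef f n).
Definition fps_add f g : fps R := FPS (fun n => fps_coef f n + fps_coef g n).
Definition fps_mul f g : fps R :=
  FPS (fun n => \sum_(i < n.+1) fps_coef f i * fps_coef g (n - i)).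

Lemma fpsP f g : (forall n, fps_coef f n = fps_coef g n) -> f = g.
Proof. by case: f g => [f] [g] /= fg; congr FPS; apply/funext. Qed.

Fact fps_addA : associative fps_add.
Proof. by move=> f g h; apply: fpsP => n /=; rewrite addrA. Qed.

Fact fps_addC : commutative fps_add.
Proof. by move=> f g; apply: fpsP => n /=; rewrite addrC. Qed.

Fact fps_add0 : left_id fps_zero fps_add.
Proof. by move=> f; apply: fpsP => n /=; rewrite add0r. Qed.

Fact fps_addN : left_inverse fps_zero fps_opp fps_add.
Proof. by move=> f; apply: fpsP => n /=; rewrite addNr. Qed.

HB.instance Definition _ :=
  GRing.isZmodule.Build (fps R) fps_addA fps_addC fps_add0 fps_addN.

Let trunc n f : {poly R} := \poly_(i < n) fps_coef f i.

Let coef_mul_trunc N n f g : (n < N)%N ->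
  fps_coef (fps_mul f g) n = (trunc N f * trunc N g)`_n.
Proof.
move=> ltnN; rewrite coefM; apply: eq_bigr => i _.
rewrite !coef_poly (leq_ltn_trans _ ltnN) ?(leq_ltn_trans _ ltnN) ?leq_subr //.
by rewrite -ltnS ltn_ord.
Qed.

Fact fps_mulC : commutative fps_mul.
Proof.
move=> f g; apply: fpsP => n.
by rewrite !(@coef_mul_trunc n.+1) // mulrC.
Qed.

Fact fps_mulA : associative fps_mul.
Proof.
move=> f g h; apply: fpsP => n.
transitivity ((trunc n.+1 f * (trunc n.+1 g * trunc n.+1 h))`_n).
  rewrite coefM /=; apply: eq_bigr => i _; rewrite coef_poly ltn_ord.
  by congr (_ * _); apply: coef_mul_trunc; rewrite ltnS leq_subr.
rewrite mulrA coefM /=; apply: eq_bigr => i _.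
rewrite [(trunc n.+1 h)`_ _]coef_poly ltnS leq_subr.
by congr (_ * _); symmetry; apply: coef_mul_trunc.
Qed.

Fact fps_mul1 : left_id fps_one fps_mul.
Proof.
move=> f; apply: fpsP => n /=; rewrite big_ord_recl /= mul1r subn0.
by rewrite big1 ?addr0 // => i _; rewrite /= mul0r.
Qed.

Fact fps_mulDl : left_distributive fps_mul +%R.
Proof.
move=> f g h; apply: fpsP => n /=; rewrite -big_split /=.
by apply: eq_bigr => i _; rewrite mulrDl.
Qed.

Fact fps_oner_neq0 : fps_one != 0.
Proof.
apply/eqP => /(congr1 (fun f => fps_coef f 0)) /= /eqP.
by rewrite oner_eq0.
Qed.

HB.instance Definition _ := GRing.Zmodule_isComNzRing.Build (fps R)
  fps_mulA fps_mulC fps_mul1 fps_mulDl fps_oner_neq0.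

Definition fps_unit : {pred fps R} := [pred f | fps_coef f 0 \is a GRing.unit].

(* The first n coefficients of the inverse of f, when f is a unit. *)
Fixpoint fps_inv_seq f n : seq R :=
  if n is m.+1 then
    let s := fps_inv_seq f m in
    rcons s ((fps_coef f 0)^-1 *
             ((m == 0%N)%:R - \sum_(i < m) fps_coef f (m - i) * s`_i))
  else [::].

Definition fps_inv f : fps R :=
  if f \in fps_unit then FPS (fun n => (fps_inv_seq f n.+1)`_n) else f.

Let size_fps_inv_seq f n : size (fps_inv_seq f n) = n.
Proof. by elim: n => //= n IHn; rewrite size_rcons IHn. Qed.

Let nth_fps_inv_seq f n i : (i < n)%N ->
  (fps_inv_seq f n)`_i = (fps_inv_seq f i.+1)`_i.
Proof.
elim: n => // n IHn; rewrite ltnS leq_eqVlt => /predU1P[-> // | ltin].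
by rewrite [in LHS]/= nth_rcons size_fps_inv_seq ltin IHn.
Qed.

Fact fps_mulVf : {in fps_unit, left_inverse 1 fps_inv *%R}.
Proof.
move=> f Uf; rewrite mulrC; apply: fpsP => n.
rewrite -[f * _]/(fps_mul f _) fps_mulC /fps_inv Uf /=.
rewrite big_ord_recr /= nth_rcons size_fps_inv_seq ltnn eqxx subnn.
rewrite mulrC mulrA divrr // mul1r addrC.
rewrite [X in _ - X](eq_bigr (fun i : 'I_n =>
  (fps_inv_seq f i.+1)`_i * fps_coef f (n - i))); first by rewrite subrK.
by move=> i _; rewrite nth_fps_inv_seq // mulrC.
Qed.

Fact fps_unitPl f g : g * f = 1 -> fps_unit f.
Proof.
move=> /(congr1 (fun h => fps_coef h 0)).
rewrite /= big_ord_recl big_ord0 addr0 subnn => gf1.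
by apply/unitrP; exists (fps_coef g 0); split; rewrite // mulrC.
Qed.

Fact fps_inv_out : {in [predC fps_unit], fps_inv =1 id}.
Proof. by move=> f; rewrite inE /fps_inv => /negbTE ->. Qed.

HB.instance Definition _ := GRing.ComNzRing_hasMulInverse.Build (fps R)
  fps_mulVf fps_unitPl fps_inv_out.

End FPSRing.

Lemma fps_unitE (R : comUnitRingType) (f : fps R) :
  (f \is a GRing.unit) = (fps_coef f 0 \is a GRing.unit).
Proof. by []. Qed.

Lemma fps_coefD (R : comUnitRingType) (f g : fps R) n :
  fps_coef (f + g) n = fps_coef f n + fps_coef g n.
Proof. by []. Qed.

Lemma fps_coefN (R : comUnitRingType) (f : fps R) n :
  fps_coef (- f) n = - fps_coef f n.
Proof. by []. Qed.

Lemma fps_coefM (R : comUnitRingType) (f g : fps R) n :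
  fps_coef (f * g) n = \sum_(i < n.+1) fps_coef f i * fps_coef g (n - i).
Proof. by []. Qed.

Definition fpsC (R : comUnitRingType) (c : R) : fps R :=
  FPS (fun n => if n == 0%N then c else 0).

Definition fpsX (R : comUnitRingType) : fps R := FPS (fun n => (n == 1%N)%:R).

(* Exponential generating function; meaningful when the factorials are
   invertible in R, e.g. over a field of characteristic 0. *)
Definition egf (R : comUnitRingType) (a : nat -> R) : fps R :=
  FPS (fun n => a n / n`!%:R).

(* exp (c x) *)
Definition fps_expX (R : comUnitRingType) (c : R) : fps R :=
  egf (fun n => c ^+ n).

(* A letter is a pair (unbarred?, i), where i : 'I_n stands for the absolute
   value i + 1.  Since false < true, the lexicographic order is
   bar 1 < ... < bar n < 1 < ... < n. *)
Definition letter (n : nat) := (bool *l 'I_n)%type.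

Definition unbarred n (l : letter n) : bool := l.1.
Definition letter_abs n (l : letter n) : 'I_n := l.2.

Definition signed_perms (n : nat) : {set n.-tuple (letter n)} :=
  [set w : n.-tuple (letter n) |
    perm_eq [seq letter_abs l | l <- w] (enum 'I_n)].

Definition pdes n (w : n.-tuple (letter n)) : nat :=
  #|[set i : 'I_n | [exists j : 'I_n,
      [&& j == i.+1 :> nat, unbarred (tnth w i), unbarred (tnth w j)
        & (tnth w j < tnth w i)%O]]]|.

(* The polynomials p_n, p_n^+ and p_n^- in the variable q = 'X. *)
Definition pdes_poly (n : nat) : {poly rat} :=
  if n is m.+1 then \sum_(w in signed_perms m.+1) 'X^(pdes w) else 1.

Definition pdes_poly_pos (n : nat) : {poly rat} :=
  if n is m.+1 then
    \sum_(w in signed_perms m.+1 | unbarred (thead w)) 'X^(pdes w)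
  else 1.

Definition pdes_poly_neg (n : nat) : {poly rat} :=
  if n is m.+1 then
    \sum_(w in signed_perms m.+1 | ~~ unbarred (thead w)) 'X^(pdes w)
  else 0.

(* Q(q), its indeterminate, and the egfs P, P^+, P^- in Q(q)[[x]]. *)
Notation Qq := {fraction {poly rat}}.

Definition qvar : Qq := tofrac 'X.

Definition pdes_egf : fps Qq := egf (fun n => tofrac (pdes_poly n)).
Definition pdes_egf_pos : fps Qq := egf (fun n => tofrac (pdes_poly_pos n)).
Definition pdes_egf_neg : fps Qq := egf (fun n => tofrac (pdes_poly_neg n)).

Lemma pdes_den_coef0 (R : comUnitRingType) (c : R) :
  fps_coef (fpsX R * fpsC c - fpsX R - fpsC c + fps_expX (c - 1)) 0 = 1 - c.
Proof.
rewrite !fps_coefD !fps_coefN fps_coefM big_ord_recl big_ord0.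
by rewrite /= mul0r !addr0 subr0 sub0r expr0 fact0 divr1 addrC.
Qed.

(* Division by this series is therefore never the junk inverse of a nonunit. *)
Fact pdes_den_unit :
  fpsX Qq * fpsC qvar - fpsX Qq - fpsC qvar + fps_expX (qvar - 1)
    \is a GRing.unit.
Proof.
rewrite fps_unitE pdes_den_coef0 unitfE subr_eq0 eq_sym.
rewrite /qvar -(rmorph1 (@tofrac _)) tofrac_eq.
apply/eqP => /(congr1 (fun p : {poly rat} => p`_1)) /eqP.
by rewrite coefX coef1.
Qed.

(* Main.v *)
(* Marking descents turns q^pdes into a sum of (q - 1)^(#marked descents); the
   initial marked run of a word with unbarred head is a decreasing sequence of
   k >= 1 unbarred letters, freely chosen, so that
     p_n = n p_(n-1) + sum_(k >= 1) C(n, k) (q - 1)^(k-1) p_(n-k),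
   the first term counting the words with barred head.  The recursion is
   obtained without marked words: read a word from the left, remembering only
   how many of the remaining absolute values would create a descent. *)

Require Import Defs.
From mathcomp Require Import all_boot all_order all_algebra fraction.
From mathcomp Require Import ring.
Import GRing.Theory.
Local Open Scope ring_scope.

Set Implicit Arguments.
Unset Strict Implicit.
Unset Printing Implicit Defensive.

(** * Binomial recursion for the descent polynomials *)

(* Descent polynomial of the words on n given absolute values that follow a
   letter exceeding exactly j of them (as unbarred letters): the next letter is
   barred, or unbarred and of rank r. *)
Fixpoint gpoly (n j : nat) : {poly rat} :=
  if n is m.+1 then
    gpoly m 0 *+ m.+1 + \sum_(r < m.+1) 'X^(r < j) * gpoly m r
  else 1.

Lemma sum_bin_col j k : (\sum_(r < j) 'C(r, k) = 'C(j, k.+1))%N.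
Proof.
elim: j => [|j IHj]; first by rewrite big_ord0.
by rewrite big_ord_recr IHj binS.
Qed.

(** Ranks below [j] carry the factor ['X] and all others the factor 1, so raising the threshold from
    0 to [j] adds [('X - 1) * gpoly n r] for each [r < j]. *)
Lemma gpolyS_threshold n j : (j <= n.+1)%N ->
  gpoly n.+1 j = gpoly n.+1 0 + ('X - 1) * \sum_(r < j) gpoly n r.
Proof.
move=> le_jn /=; rewrite -addrA; congr (_ + _).
rewrite (big_ord_widen _ (fun r => gpoly n r) le_jn) [X in _ * X]big_mkcond mulr_sumr.
rewrite -big_split; apply: eq_bigr => r _ /=.
by case: ltnP => _ /=; ring.
Qed.

(** Iterates [gpolyS_threshold]: each step extends a marked decreasing run by one letter, and the
    hockey-stick identity [sum_bin_col] makes ['C(j, k)] count the runs of [k] letters. *)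
Lemma gpoly_bin n j : (j <= n)%N ->
  gpoly n j = \sum_(k < n.+1) 'C(j, k)%:R * ('X - 1) ^+ k * gpoly (n - k) 0.
Proof.
elim: n j => [|n IHn] j le_jn.
  by move: le_jn; rewrite leqn0 => /eqP->; rewrite big_ord1 bin0 expr0 !mul1r.
rewrite gpolyS_threshold // big_ord_recl bin0 expr0 !mul1r subn0; congr (_ + _).
rewrite (eq_bigr (fun r : 'I_j =>
    \sum_(k < n.+1) 'C(r, k)%:R * ('X - 1) ^+ k * gpoly (n - k) 0)); last first.
  by move=> r _; rewrite IHn // -ltnS (leq_trans (ltn_ord r)).
rewrite exchange_big mulr_sumr; apply: eq_bigr => k _ /=.
rewrite -!mulr_suml -natr_sum sum_bin_col subSS exprS; ring.
Qed.

(** The recursion for p_n once [pdes_polyE] is known; the marked run has length [k.+1], its head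
    included. *)
Lemma gpolyS0 n :
  gpoly n.+1 0 = gpoly n 0 *+ n.+1 +
    \sum_(k < n.+1) 'C(n.+1, k.+1)%:R * ('X - 1) ^+ k * gpoly (n - k) 0.
Proof.
rewrite [LHS]/=; congr (_ + _).
under eq_bigr => r _ do rewrite expr0 mul1r gpoly_bin ?leq_ord //.
rewrite exchange_big; apply: eq_bigr => k _ /=.
by rewrite -!mulr_suml -natr_sum sum_bin_col.
Qed.

(** * Descents read letter by letter *)

(* Unbarred letters descend from l if their absolute value is below this bound;
   a barred l gets 0, so that nothing descends from it. *)
Definition threshold N (l : letter N) : nat :=
  if unbarred l then letter_abs l : nat else 0.

Definition descends N (t : nat) (l : letter N) : bool :=
  unbarred l && (letter_abs l < t)%N.

Fixpoint pdes_from N (t : nat) (s : seq (letter N)) : nat :=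
  if s is l :: s' then descends t l + pdes_from (threshold l) s' else 0.

Lemma descendsE N (l l' : letter N) :
  descends (threshold l) l' =
  [&& unbarred l, unbarred l' & (l' < l)%O].
Proof.
by case: l l' => [[] a] [[] b]; rewrite /descends /threshold /= ?ltn0.
Qed.

Lemma pdes_fromE N x0 (l : letter N) n (s : seq (letter N)) : size s = n ->
  pdes_from (threshold l) s =
  (\sum_(i < n) descends (threshold (nth x0 (l :: s) i)) (nth x0 s i))%N.
Proof.
move=> <-; elim: s l => [|l' s IHs] l /=; first by rewrite big_ord0.
by rewrite big_ord_recl IHs.
Qed.

Lemma pdes_pdes_from n (w : n.-tuple (letter n)) : pdes w = pdes_from 0 w.
Proof.
case: n w => [|n] w.
  by rewrite tuple0 /pdes; apply: eq_card0 => -[].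
rewrite /pdes cardsE -sum1_card big_mkcond big_ord_recr /=.
(* The last position has no successor, so it contributes nothing. *)
rewrite [X in (_ + X)%N]ifF ?addn0; last first.
  by apply/existsP => -[j /andP[/eqP eq_j _]]; move: (ltn_ord j); rewrite eq_j ltnn.
(* The initial threshold 0 cancels the term of the first letter. *)
case/tupleP: w => l w; rewrite /= {1}/descends ltn0 andbF add0n.
rewrite (pdes_fromE l _ (size_tuple w)); apply: eq_bigr => i _.
rewrite descendsE !unfold_in.
set b := [exists _, _]; set b' := [&& _, _ & _].
suff -> : b = b' by case: b'.
have tnthS (j : 'I_n.+1) : j = i.+1 :> nat -> tnth [tuple of l :: w] j = nth l w i.
  by move=> eq_j; rewrite (tnth_nth l) eq_j.
rewrite /b' -[nth l (l :: w) i](tnth_nth l [tuple of l :: w] (widen_ord (leqnSn n) i)).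
apply/existsP/idP => [[j /andP[/eqP /tnthS ->]] //|h].
have lt_i : (i.+1 < n.+1)%N by rewrite ltnS.
by exists (Ordinal lt_i); rewrite eqxx (tnthS (Ordinal lt_i)).
Qed.

(** Rank is strictly increasing on [A], hence a bijection onto the integers below [#|A|]. *)
Lemma sum_rank (R : nmodType) N (A : {set 'I_N}) (F : nat -> R) :
  \sum_(a in A) F #|[set b in A | (b < a)%N]| = \sum_(r < #|A|) F r.
Proof.
pose rk (a : 'I_N) := #|[set b in A | (b < a)%N]|.
have rk_lt (a a' : 'I_N) : a \in A -> (a < a')%N -> (rk a < rk a')%N.
  move=> Aa lt_aa'; apply/proper_card/properP; split.
    by apply/subsetP => b; rewrite !inE => /andP[-> /ltn_trans->].
  by exists a; rewrite !inE Aa ?ltnn.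
have rk_inj : {in A &, injective rk}.
  move=> a a' Aa Aa' eq_rk; apply/val_inj.
  by case: (ltngtP a a') => [/(rk_lt _ _ Aa)|/(rk_lt _ _ Aa')|//]; rewrite eq_rk ltnn.
have rk_bound a : a \in A -> (rk a < #|A|)%N.
  move=> Aa; apply/proper_card/properP; split; last by exists a; rewrite // !inE ltnn andbF.
  by apply/subsetP => b; rewrite inE => /andP[].
have uniq_rk : uniq [seq rk a | a <- enum A].
  by rewrite map_inj_in_uniq ?enum_uniq // => a a'; rewrite !mem_enum; apply: rk_inj.
rewrite -big_enum -(big_map rk predT F) -(big_mkord predT F).
apply: perm_big; apply: uniq_perm; rewrite ?iota_uniq //.
apply: (uniq_min_size uniq_rk _ _).2; last by rewrite size_map size_iota subn0 cardE.
move=> _ /mapP[a Aa ->]; rewrite mem_index_iota /=; apply: rk_bound.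
by rewrite -mem_enum.
Qed.

(** Allowing any subset [A] of a fixed ['I_N] lets an induction delete used values without
    relabelling letters. *)
Definition spells N (A : {set 'I_N}) (s : seq (letter N)) : bool :=
  perm_eq [seq letter_abs l | l <- s] (enum A).

Lemma spells_cons N (A : {set 'I_N}) l s :
  spells A (l :: s) =
  (letter_abs l \in A) && spells (A :\ letter_abs l) s.
Proof.
rewrite /spells /=; case: (boolP (_ \in A)) => [Aa|/negP nAa] /=.
  have enumA : perm_eq (enum A) (letter_abs l :: enum (A :\ letter_abs l)).
    apply: uniq_perm; rewrite /= ?enum_uniq ?mem_enum ?setD11 // => b.
    by rewrite inE !mem_enum !inE; case: eqP => // ->.
  by rewrite (permPr enumA) perm_cons.
by apply/negP => /perm_mem /(_ (letter_abs l)); rewrite mem_head mem_enum => /esym.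
Qed.

Lemma sum_spells_head (R : nmodType) N k (A : {set 'I_N}) (b : bool)
    (F : seq (letter N) -> R) :
  \sum_(w : k.+1.-tuple (letter N) | spells A w && (unbarred (thead w) == b :> bool)) F w
  = \sum_(a in A) \sum_(w : k.-tuple (letter N) | spells (A :\ a) w)
      F ((b, a) :: w).
Proof.
rewrite pair_big_dep /=.
rewrite (reindex_onto (fun p : 'I_N * k.-tuple (letter N) =>
    cons_tuple ((b, p.1) : letter N) p.2)
  (fun w => (letter_abs (thead w), behead_tuple w))) /=; last first.
  case/tupleP=> l w /andP[_]; rewrite theadE => /eqP <-.
  by apply: val_inj; case: l.
apply: eq_bigl => -[a w] /=.
rewrite spells_cons eqxx andbT.
rewrite [behead_tuple _](_ : _ = w) ?eqxx ?andbT //; exact: val_inj.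
Qed.

(** Splits on the sign of the head: a barred head resets the threshold, an unbarred one is indexed
    by its rank in [A], as in [gpoly]. *)
Lemma sum_spells N k (A : {set 'I_N}) t : #|A| = k ->
  \sum_(w : k.-tuple (letter N) | spells A w) 'X^(pdes_from t w)
  = gpoly k #|[set a in A | (a < t)%N]|.
Proof.
elim: k A t => [|k IHk] A t cardA.
  have /eqP A0 : A == set0 by rewrite -cards_eq0 cardA.
  rewrite (big_pred1 [tuple]) // => w; rewrite tuple0 /spells A0 enum_set0.
  by rewrite [RHS]eqxx.
have cardD a : a \in A -> #|A :\ a| = k.
  by move=> Aa; apply/eqP; rewrite -eqSS -cardA (cardsD1 a A) Aa.
rewrite (bigID (fun w : k.+1.-tuple _ => unbarred (thead w) == false)) /=.
rewrite (sum_spells_head _ _ false (fun s => 'X^(pdes_from t s))).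
congr (_ + _).
  under eq_bigr => a Aa.
    rewrite /= IHk ?cardD //.
    rewrite [X in gpoly k X](_ : _ = 0%N); last by apply: eq_card0 => b; rewrite !inE ltn0 andbF.
  over.
  by rewrite sumr_const cardA.
under eq_bigl => w do rewrite eqbF_neg negbK -[unbarred _]eqb_id.
rewrite (sum_spells_head _ _ true (fun s => 'X^(pdes_from t s))).
rewrite -cardA -(sum_rank A (fun r => 'X^(r < _) * gpoly k r)).
apply: eq_bigr => a Aa; under eq_bigr => w _ do rewrite /= exprD.
rewrite -mulr_sumr IHk ?cardD //; congr ('X^(_) * gpoly _ _).
  (* For [a] in [A], [a < t] holds exactly when the rank of [a] is below the number of elements of
     [A] under [t]. *)
  congr nat_of_bool; rewrite /descends /=; apply/idP/idP => [lt_at|].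
    apply/proper_card/properP; split; last by exists a; rewrite !inE ?Aa ?ltnn.
    by apply/subsetP => b; rewrite !inE => /andP[-> /ltn_trans->].
  apply: contraTT; rewrite -!leqNgt => le_ta; apply/subset_leq_card/subsetP => b.
  by rewrite !inE => /andP[-> /leq_trans->].
(* Deleting [a] does not affect the values strictly below it. *)
apply: eq_card => b; rewrite !inE /threshold /=.
by case: eqP => [->|] //=; rewrite ltnn andbF.
Qed.

Lemma signed_permsE n (w : n.-tuple (letter n)) :
  (w \in signed_perms n) = spells [set: 'I_n] w.
Proof. by rewrite inE /spells enum_setT enumT. Qed.

Lemma pdes_polyE n : pdes_poly n = gpoly n 0.
Proof.
case: n => // n; rewrite /pdes_poly.
under eq_bigr do rewrite pdes_pdes_from.
under eq_bigl do rewrite signed_permsE.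
rewrite sum_spells ?cardsT ?card_ord //; congr gpoly.
by apply: eq_card0 => b; rewrite !inE.
Qed.

Lemma pdes_poly_negS n : pdes_poly_neg n.+1 = pdes_poly n *+ n.+1.
Proof.
rewrite pdes_polyE /pdes_poly_neg.
under eq_bigr do rewrite pdes_pdes_from.
under eq_bigl do rewrite signed_permsE -eqbF_neg.
rewrite (sum_spells_head _ _ false (fun s => 'X^(pdes_from 0 s))).
rewrite (eq_bigr (fun=> gpoly n 0)); first by rewrite sumr_const cardsT card_ord.
move=> a _ /=; rewrite sum_spells; last first.
  by have := cardsD1 a setT; rewrite cardsT card_ord in_setT add1n => -[].
by congr gpoly; apply: eq_card0 => b; rewrite !inE ltn0 andbF.
Qed.

Lemma pdes_poly_split n : pdes_poly n = pdes_poly_pos n + pdes_poly_neg n.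
Proof.
case: n => [|n] /=; first by rewrite addr0.
by rewrite (bigID (fun w : n.+1.-tuple _ => unbarred (thead w))).
Qed.

(** * Exponential generating functions *)

Lemma coef_fpsXM (R : comUnitRingType) (f : fps R) n :
  fps_coef (fpsX R * f) n = if n is m.+1 then fps_coef f m else 0.
Proof.
rewrite fps_coefM; case: n => [|n]; first by rewrite big_ord1 /= mul0r.
rewrite 2!big_ord_recl /= mul0r add0r mul1r subSS subn0 big1 ?addr0 // => i _.
by rewrite mul0r.
Qed.

Lemma coef_fpsCM (R : comUnitRingType) c (f : fps R) n :
  fps_coef (fpsC c * f) n = c * fps_coef f n.
Proof.
by rewrite fps_coefM big_ord_recl /= subn0 big1 ?addr0 // => i _; rewrite mul0r.
Qed.

Lemma coef_egfM (F : fieldType) (a b : nat -> F) n :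
  (forall m, m`!%:R != 0 :> F) ->
  fps_coef (egf a * egf b) n =
  (\sum_(k < n.+1) 'C(n, k)%:R * a k * b (n - k)%N) / n`!%:R.
Proof.
move=> fact_neq0; rewrite fps_coefM mulr_suml; apply: eq_bigr => k _ /=.
have le_kn : (k <= n)%N by rewrite -ltnS.
have := fact_neq0 n; rewrite -(bin_fact le_kn) !natrM mulf_eq0 negb_or.
case/andP=> bin_neq0 _; field.
by rewrite !fact_neq0.
Qed.

(** At [n = 0] the value [0.-1 = 0] is harmless, since the factor [n%:R] vanishes. *)
Lemma fpsXM_egf (F : fieldType) (a : nat -> F) :
  (forall m, m`!%:R != 0 :> F) ->
  fpsX F * egf a = egf (fun n => n%:R * a n.-1).
Proof.
move=> fact_neq0; apply: fpsP => -[|n]; rewrite coef_fpsXM /= ?mul0r //.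
have := fact_neq0 n.+1; rewrite factS natrM mulf_eq0 negb_or.
by case/andP=> n1_neq0 _; rewrite -mulf_div divff // mul1r.
Qed.

Lemma egf_den (F : fieldType) (q : F) (a : nat -> F) :
  (forall m, m`!%:R != 0 :> F) -> a 0%N = 1 ->
  (forall n, a n.+1 = n.+1%:R * a n +
     \sum_(k < n.+1) 'C(n.+1, k.+1)%:R * (q - 1) ^+ k * a (n - k)%N) ->
  egf a * (fpsX F * fpsC q - fpsX F - fpsC q + fps_expX (q - 1)) = 1 - fpsC q.
Proof.
move=> fact_neq0 a0 aS.
have -> : egf a * (fpsX F * fpsC q - fpsX F - fpsC q + fps_expX (q - 1)) =
    fpsC q * (fpsX F * egf a) - fpsX F * egf a - fpsC q * egf a
    + fps_expX (q - 1) * egf a by ring.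
rewrite fpsXM_egf //; apply: fpsP => n.
rewrite !(fps_coefD, fps_coefN) !coef_fpsCM coef_egfM //; case: n => [|n].
  by rewrite big_ord1 /= a0 fact0 bin0 expr0 !divr1 !mulr1; ring.
rewrite big_ord_recl bin0 expr0 !mul1r subn0 /= subr0.
under [X in _ + (_ + X) / _]eq_bigr => k _ do rewrite subSS exprS.
set S := \sum_(k < n.+1) _.
(* The [k = 0] term of the convolution has been split off; the rest is the recursion times [q - 1],
   which cancels the other terms. *)
have -> : S = (q - 1) * (a n.+1 - n.+1%:R * a n).
  by rewrite aS addrAC subrr add0r mulr_sumr; apply: eq_bigr => k _ /=; ring.
by field; rewrite fact_neq0.
Qed.

Lemma fact_neq0_Qq n : n`!%:R != 0 :> Qq.
Proof.
rewrite -(rmorph_nat (@tofrac {poly rat})) tofrac_eq0 -polyC_natr polyC_eq0.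
by rewrite Num.Theory.pnatr_eq0 -lt0n fact_gt0.
Qed.

Theorem theorem1 :
  let x : fps Qq := fpsX Qq in
  let q : fps Qq := fpsC qvar in
  let D : fps Qq := x * q - x - q + fps_expX (qvar - 1) in
  [/\ pdes_egf = (1 - q) / D,
      pdes_egf_pos = (1 - x) * (1 - q) / D
    & pdes_egf_neg = x * (1 - q) / D].
Proof.
move=> x q D.
have PD : pdes_egf * D = 1 - q.
  apply: egf_den => [||n]; first exact: fact_neq0_Qq.
    exact: rmorph1.
  rewrite !pdes_polyE gpolyS0 rmorphD rmorphMn rmorph_sum mulr_natl /=.
  congr (_ + _); apply: eq_bigr => k _.
  by rewrite pdes_polyE !rmorphM rmorphXn rmorphB rmorph1 rmorph_nat.
have P_eq : pdes_egf = (1 - q) / D by rewrite -PD mulrK // pdes_den_unit.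
have N_eq : pdes_egf_neg = x * pdes_egf.
  rewrite (fpsXM_egf _ fact_neq0_Qq); congr egf; apply/boolp.funext => -[|n].
    by rewrite rmorph0 mul0r.
  by rewrite pdes_poly_negS rmorphMn mulr_natl.
(* Together with [N_eq] this gives P^+ = (1 - x) P. *)
have S_eq : pdes_egf_pos = pdes_egf - pdes_egf_neg.
  apply: fpsP => n; rewrite fps_coefD fps_coefN /=.
  by rewrite pdes_poly_split rmorphD mulrDl addrK.
split=> //; last by rewrite N_eq P_eq mulrA.
by rewrite -mulrA -P_eq mulrBl mul1r -N_eq.
Qed.
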